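(* Let $\mathbf{A} \in \mathbb{C}^{m \times p}$ and let $\boldsymbol{\Psi} \in \mathbb{C}^{n \times p}$, with $n \ge p$, be a full-rank matrix (i.e. of full column rank). Assume that all columns of $\mathbf{A}\boldsymbol{\Psi}^\dagger$ are nonzero. Let $k$ be a nonnegative integer such that $$k < \frac{1}{2}\left(1 + \frac{1}{\hat\mu(\mathbf{A}\boldsymbol{\Psi}^\dagger)}\right).$$ Then there exist constants $C_0, C_1 \ge 0$, depending only on $\mathbf{A}, \boldsymbol{\Psi}, k$ (in particular not on $\mathbf{x}$), such that the following holds. For all $\varepsilon \ge 0$, all $\mathbf{x} \in \mathbb{C}^p$, and all $\mathbf{e} \in \mathbb{C}^m$ with $\|\mathbf{e}\|_2 \le \varepsilon$, if $\mathbf{y} = \mathbf{A}\mathbf{x} + \mathbf{e}$ and $\mathbf{x}^*$ is a solution of the convex program $$\underset{\widetilde{\mathbf{x}} \in \mathbb{C}^p}{\text{minimize}}\ \|\boldsymbol{\Psi}\widetilde{\mathbf{x}}\|_1 \quad \text{subject to}\quad \|\mathbf{y} - \mathbf{A}\widetilde{\mathbf{x}}\|_2 \le \varepsilon,$$ then $$\|\mathbf{x}^* - \mathbf{x}\|_2 \le C_0\,\varepsilon + C_1\,\sigma_k(\boldsymbol{\Psi}\mathbf{x}).$$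
   Context: Notation. $\mathbf{M}^H$ is the conjugate transpose, $\mathbf{M}^\dagger$ the Moore–Penrose inverse, $[\mathbf{M}]_j$ the $j$th column and $[\mathbf{M}]_{i,j}$ the $(i,j)$ entry of a matrix $\mathbf{M}$. For a complex vector $\mathbf{u}$, $\|\mathbf{u}\|_1 = \sum_k |[\mathbf{u}]_k|$ and $\|\mathbf{u}\|_2$ is the Euclidean norm. Put $\omega_{\min}(\mathbf{M}) = \min_j \|[\mathbf{M}]_j\|_2$. Coherence. For a matrix $\mathbf{M}$ with nonzero (not necessarily normalized) columns, its coherence is $$\hat\mu(\mathbf{M}) = \max_{i \ne j} \frac{|[\mathbf{M}^H\mathbf{M}]_{i,j}|}{\omega_{\min}^2(\mathbf{M})}.$$ Best $k$-term approximation error. For a vector $\mathbf{u}$, $\sigma_k(\mathbf{u}) = \|\mathbf{u} - \mathbf{u}_{\mathcal{S}}\|_1$, where $\mathcal{S}$ is the set of indices of the $k$ largest (in magnitude) entries of $\mathbf{u}$ and $\mathbf{u}_{\mathcal{S}}$ agrees with $\mathbf{u}$ on $\mathcal{S}$ and vanishes elsewhere ($\sigma_k(\mathbf{u}) = 0$ if $k$ is at least the length of $\mathbf{u}$). Conventions: a maximum over an empty index set is $0$; $1/0 = +\infty$. *)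

(* Defs.v *)
(* The field of complex numbers is R[i] for R : realType. *)
From HB Require Import structures.
From mathcomp Require Import all_boot all_order all_algebra.
From mathcomp Require Import complex.
From mathcomp Require Import boolp classical_sets reals constructive_ereal.

Set Implicit Arguments.
Unset Strict Implicit.
Unset Printing Implicit Defensive.

Import Order.TTheory GRing.Theory Num.Theory.

Local Open Scope ring_scope.
Local Open Scope complex_scope.
Local Open Scope sesquilinear_scope.

Section Norms.
Variable R : realType.

(* [Normc.normc] is the complex modulus as an element of R. *)
Definition norm1 n (u : 'cV[R[i]]_n) : R := \sum_(i < n) Normc.normc (u i 0).

Definition norm2 n (u : 'cV[R[i]]_n) : R :=
  Num.sqrt (\sum_(i < n) Normc.normc (u i 0) ^+ 2).

(* The minimum is taken in \bar R, where the empty minimum is +oo; it is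
   finite as soon as 0 < n, and [fine] makes the value for n = 0 be 0. *)
Definition omega_min m n (M : 'M[R[i]]_(m, n)) : R :=
  fine (\big[Order.min/+oo%E]_(j < n) (norm2 (col j M))%:E).

Definition coherence m n (M : 'M[R[i]]_(m, n)) : R :=
  \big[Num.max/0]_(ij : 'I_n * 'I_n | ij.1 != ij.2)
    (Normc.normc ((M^t* *m M) ij.1 ij.2) / omega_min M ^+ 2).

End Norms.

Section BestTermApproximation.
Variable R : realType.

(* The k first indices when sorting by decreasing modulus, all of them when
   k is at least n. Ties go to the smaller index (the sort is stable). *)
Definition largest_entries k n (u : 'cV[R[i]]_n) : seq 'I_n :=
  take k (sort (fun i j => Normc.normc (u j 0) <= Normc.normc (u i 0))
               (enum 'I_n)).

Definition restrict_to n (S : seq 'I_n) (u : 'cV[R[i]]_n) : 'cV[R[i]]_n :=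
  \col_i (if i \in S then u i 0 else 0).

Definition sigma k n (u : 'cV[R[i]]_n) : R :=
  norm1 (u - restrict_to (largest_entries k u) u).

End BestTermApproximation.

Section MoorePenrose.
Variable C : numClosedFieldType.

Definition penrose m n (M : 'M[C]_(m, n)) (X : 'M[C]_(n, m)) : Prop :=
  [/\ M *m X *m M = M, X *m M *m X = X,
      (M *m X)^t* = M *m X & (X *m M)^t* = X *m M].

(* The default 0 is never used: see [penrose_exists]. *)
Definition mpinv m n (M : 'M[C]_(m, n)) : 'M[C]_(n, m) :=
  xget 0 [set X | penrose M X]%classic.

Lemma trmxC_mul m n p (M : 'M[C]_(m, n)) (N : 'M[C]_(n, p)) :
  (M *m N)^t* = N^t* *m M^t*.
Proof. by rewrite trmx_mul map_mxM. Qed.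

Lemma mulmx_trmxC_eq0 m n (M : 'M[C]_(m, n)) : M *m M^t* = 0 -> M = 0.
Proof.
move=> /matrixP M0; apply/matrixP => i j; rewrite mxE.
have := M0 i i; rewrite !mxE => /eqP.
rewrite psumr_eq0 => [/allP /(_ j)|k _]; last by rewrite !mxE mul_conjC_ge0.
by rewrite mem_index_enum !mxE mul_conjC_eq0 => /(_ isT)/eqP.
Qed.

Lemma gram_unitmx m n (B : 'M[C]_(m, n)) :
  row_free B -> B *m B^t* \in unitmx.
Proof.
move=> Bfree; rewrite -row_free_unit -kermx_eq0; apply/eqP.
set K := kermx _; have K0 : K *m (B *m B^t*) = 0 by exact: mulmx_ker.
have /eqP : K *m B = 0.
  by apply: mulmx_trmxC_eq0; rewrite trmxC_mul !mulmxA -(mulmxA K) K0 mul0mx.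
by rewrite mulmx_free_eq0// => /eqP.
Qed.

Lemma penrose_factor m n r (A : 'M[C]_(m, r)) (B : 'M[C]_(r, n)) :
  row_full A -> row_free B -> exists X, penrose (A *m B) X.
Proof.
move=> Afull Bfree.
have UB : B *m B^t* \in unitmx by exact: gram_unitmx.
have UA : A^t* *m A \in unitmx.
  rewrite -[X in _ *m X]trmxCK; apply: gram_unitmx.
  by rewrite /row_free mxrank_map mxrank_tr.
set G := B *m B^t* in UB; set H := A^t* *m A in UA.
have Gh : G^t* = G by rewrite trmxC_mul trmxCK.
have Hh : H^t* = H by rewrite trmxC_mul trmxCK.
have invh (T : 'M[C]_r) : T^t* = T -> (invmx T)^t* = invmx T.
  by move=> Th; rewrite trmx_inv map_invmx Th.
pose X := B^t* *m invmx G *m (invmx H *m A^t*).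
have MX : A *m B *m X = A *m invmx H *m A^t*.
  by rewrite /X !mulmxA -(mulmxA A B) -/G mulmxK.
have XM : X *m (A *m B) = B^t* *m invmx G *m B.
  by rewrite /X -!mulmxA (mulmxA (A^t*)) -/H (mulmxA (invmx H)) mulVmx// mul1mx.
exists X; split.
- by rewrite MX -!mulmxA (mulmxA (A^t*)) -/H (mulmxA (invmx H)) mulVmx// mul1mx.
- rewrite XM /X -!mulmxA (mulmxA B (B^t*)) -/G (mulmxA G (invmx G)) mulmxV//.
  by rewrite mul1mx.
- by rewrite MX !trmxC_mul trmxCK invh// mulmxA.
- by rewrite XM !trmxC_mul trmxCK invh// mulmxA.
Qed.

Lemma penrose_exists m n (M : 'M[C]_(m, n)) : exists X, penrose M X.
Proof.
by rewrite -(mulmx_base M); apply: penrose_factor;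
  [exact: col_base_full | exact: row_base_free].
Qed.

Lemma penrose_unique m n (M : 'M[C]_(m, n)) X Y :
  penrose M X -> penrose M Y -> X = Y.
Proof.
move=> [MXM XMX MXh XMh] [MYM YMY MYh YMh].
have MXY : M *m X = M *m Y.
  by rewrite -MXh -{1}MYM -!mulmxA mulmxA trmxC_mul MXh MYh !mulmxA MXM.
have XMY : X *m M = Y *m M.
  by rewrite -XMh -{1}MYM !mulmxA -(mulmxA _ Y) trmxC_mul XMh YMh -mulmxA (mulmxA M) MXM.
by rewrite -XMX XMY -mulmxA MXY mulmxA YMY.
Qed.

Lemma mpinvP m n (M : 'M[C]_(m, n)) : penrose M (mpinv M).
Proof. by have [X MX] := penrose_exists M; exact: xgetI MX. Qed.

End MoorePenrose.

Section ConvexProgram.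
Variable R : realType.

Definition feasible m p (A : 'M[R[i]]_(m, p)) (y : 'cV[R[i]]_m) (eps : R)
    (z : 'cV[R[i]]_p) : Prop :=
  norm2 (y - A *m z) <= eps.

Definition is_solution m n p (A : 'M[R[i]]_(m, p)) (Psi : 'M[R[i]]_(n, p))
    (y : 'cV[R[i]]_m) (eps : R) (xs : 'cV[R[i]]_p) : Prop :=
  feasible A y eps xs /\
  forall z, feasible A y eps z -> norm1 (Psi *m xs) <= norm1 (Psi *m z).

End ConvexProgram.

(* Main.v *)
(* Put M := A Psi^+ and h := Psi (x^* - x), so that M h = A (x^* - x) has size
   at most 2 eps.  Reading M^H M h row by row, the coherence mu bounds the
   off-diagonal terms and gives (1 + mu) |h_i| <= B eps + mu |h|_1 for every i.
   Optimality of x^* puts h in the cone |h|_1 <= 2 |h_S|_1 + 2 sigma_k(Psi x);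
   summing the entrywise bound over S, |S| <= k, yields
   (1 + mu - 2 k mu) |h|_1 <= 2 k B eps + 2 (1 + mu) sigma_k(Psi x), whose
   left factor is positive by the hypothesis on k.  Finally
   x^* - x = Psi^+ h. *)
Require Import Defs.
From mathcomp Require Import all_boot all_order all_algebra.
From mathcomp Require Import complex.
From mathcomp Require Import reals constructive_ereal.
From mathcomp Require Import ring lra.

Set Implicit Arguments.
Unset Strict Implicit.
Unset Printing Implicit Defensive.

Import Order.TTheory GRing.Theory Num.Theory.

Local Open Scope ring_scope.
Local Open Scope complex_scope.
Local Open Scope sesquilinear_scope.

(** * The complex modulus as a real number *)

Section Modulus.
Variable R : realType.
Implicit Types x y : R[i].
Local Notation normc := (@Normc.normc R).

Lemma normc_ge0 x : 0 <= normc x.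
Proof. by case: x => a b; rewrite sqrtr_ge0. Qed.

Lemma normc_triangle x y : normc (x + y) <= normc x + normc y.
Proof. exact: le_normcD. Qed.

Lemma normc_opp x : normc (- x) = normc x.
Proof. exact: normcN. Qed.

Lemma normc_distr x y : normc (x - y) <= normc x + normc y.
Proof. by rewrite -(normc_opp y) normc_triangle. Qed.

Lemma normc_real (r : R) : 0 <= r -> normc r%:C = r.
Proof. by move=> r0; rewrite /= expr0n addr0 sqrtr_sqr ger0_norm. Qed.

Lemma normrc x : `|x| = (normc x)%:C.
Proof. by []. Qed.

Lemma normc_conj x : normc x^* = normc x.
Proof. by apply/complexI; rewrite -!normrc norm_conjC. Qed.

Lemma normc_sum (I : finType) (P : pred I) (F : I -> R[i]) :
  normc (\sum_(i | P i) F i) <= \sum_(i | P i) normc (F i).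
Proof.
elim/big_ind2 : _ => [|a b c d ha hc|//]; first by rewrite Normc.normc0.
exact: le_trans (normc_triangle _ _) (lerD ha hc).
Qed.

End Modulus.

(** * Vector norms and a crude operator bound *)

Section VectorNorms.
Variable R : realType.
Local Notation normc := (@Normc.normc R).

Lemma norm1_ge0 n (u : 'cV[R[i]]_n) : 0 <= norm1 u.
Proof. by apply: sumr_ge0 => i _; exact: normc_ge0. Qed.

Lemma normc_le_norm2 n (u : 'cV[R[i]]_n) i : normc (u i 0) <= norm2 u.
Proof.
rewrite -[leLHS]ger0_norm ?normc_ge0// -sqrtr_sqr ler_wsqrtr//.
by rewrite (bigD1 i)//= lerDl sumr_ge0// => j _; rewrite sqr_ge0.
Qed.

Lemma norm2_le_norm1 n (u : 'cV[R[i]]_n) : norm2 u <= norm1 u.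
Proof.
rewrite -[leRHS]ger0_norm ?norm1_ge0// -sqrtr_sqr ler_wsqrtr//.
rewrite [leRHS]expr2 {1}/norm1 mulr_suml ler_sum// => i _.
rewrite expr2 ler_wpM2l ?normc_ge0// /norm1 (bigD1 i)//= lerDl.
by apply: sumr_ge0 => j _; exact: normc_ge0.
Qed.

Lemma norm2_gt0 n (u : 'cV[R[i]]_n) : u != 0 -> 0 < norm2 u.
Proof.
apply: contraNT; rewrite -leNgt => u0; apply/eqP/matrixP => i j.
rewrite ord1 mxE; apply: Normc.eq0_normc; apply/eqP; rewrite eq_le normc_ge0.
by rewrite andbT (le_trans (normc_le_norm2 u i)).
Qed.

(** The entrywise l1 norm. Only the existence of constants is claimed, so this crude bound can serve
    wherever an operator norm is wanted. *)
Definition entry_sum m n (M : 'M[R[i]]_(m, n)) : R := \sum_j norm1 (col j M).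

Lemma entry_sum_ge0 m n (M : 'M[R[i]]_(m, n)) : 0 <= entry_sum M.
Proof. by apply: sumr_ge0 => j _; exact: norm1_ge0. Qed.

Lemma norm1_col_le m n (M : 'M[R[i]]_(m, n)) j : norm1 (col j M) <= entry_sum M.
Proof.
by rewrite /entry_sum (bigD1 j)//= lerDl sumr_ge0// => i _; exact: norm1_ge0.
Qed.

Lemma norm1_mulmx m n (M : 'M[R[i]]_(m, n)) (u : 'cV_n) :
  norm1 (M *m u) <= entry_sum M * norm1 u.
Proof.
apply: (@le_trans _ _ (\sum_j norm1 (col j M) * normc (u j 0))); last first.
  rewrite {2}/norm1 mulr_sumr ler_sum// => j _.
  by rewrite ler_wpM2r ?normc_ge0// norm1_col_le.
under [leRHS]eq_bigr do rewrite /norm1 mulr_suml.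
rewrite exchange_big ler_sum//= => i _; rewrite mxE.
apply: le_trans (normc_sum _ _) _; rewrite ler_sum// => j _.
by rewrite Normc.normcM mxE.
Qed.

End VectorNorms.

(** * The Gram matrix and entrywise bounds from coherence *)

Section Coherence.
Variables (R : realType) (m n : nat) (M : 'M[R[i]]_(m, n)).
Hypothesis Mcol : forall j, col j M != 0.
Local Notation normc := (@Normc.normc R).
Local Notation w := (omega_min M).
Local Notation mu := (coherence M).

(* The index only witnesses [0 < n]: [omega_min M] is [0] when [n = 0]. *)
Lemma EFin_omega_min (i : 'I_n) :
  (w%:E = \big[Order.min/+oo]_(j < n) (norm2 (col j M))%:E)%E.
Proof.
rewrite /omega_min fineK// fin_real//; apply/andP; split.
  by apply: Order.POrderTheory.lt_bigmin => // j _; rewrite ltNyr.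
exact: le_lt_trans (bigmin_le _ i _) (ltry _).
Qed.

Lemma omega_min_gt0 (i : 'I_n) : 0 < w.
Proof.
rewrite -lte_fin (EFin_omega_min i).
apply: Order.POrderTheory.lt_bigmin => [|j _]; first by rewrite ltry.
by rewrite lte_fin norm2_gt0.
Qed.

Lemma omega_min_le (i : 'I_n) : w <= norm2 (col i M).
Proof. by rewrite -lee_fin (EFin_omega_min i) bigmin_le. Qed.

Lemma coherence_ge0 : 0 <= mu.
Proof. exact: bigmax_ge_id. Qed.

Lemma gram_offdiag i j : i != j -> normc ((M^t* *m M) i j) <= mu * w ^+ 2.
Proof.
move=> ij; rewrite -ler_pdivrMr ?exprn_gt0 ?omega_min_gt0//.
exact: (le_bigmax_cond _ (j := (i, j))
  (fun ij => normc ((M^t* *m M) ij.1 ij.2) / w ^+ 2)).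
Qed.

Lemma gram_diag i : normc ((M^t* *m M) i i) = norm2 (col i M) ^+ 2.
Proof.
rewrite sqr_sqrtr; last by rewrite sumr_ge0// => l _; rewrite sqr_ge0.
rewrite mxE -[RHS]normc_real; last by rewrite sumr_ge0// => l _; rewrite sqr_ge0.
congr normc; rewrite rmorph_sum; apply: eq_bigr => l _.
by rewrite !mxE rmorphXn/= -normrc normCK mulrC.
Qed.

Lemma gram_mul_le (h : 'cV[R[i]]_n) (t : R) i : 0 <= t ->
    (forall l, normc ((M *m h) l 0) <= t) ->
  normc ((M^t* *m M *m h) i 0) <= entry_sum M * t.
Proof.
move=> t0 ht; rewrite -mulmxA mxE; apply: le_trans (normc_sum _ _) _.
apply: (@le_trans _ _ (norm1 (col i M) * t)).
  rewrite /norm1 mulr_suml ler_sum// => l _.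
  by rewrite Normc.normcM ler_pM ?normc_ge0 ?ht// !mxE normc_conj.
by rewrite ler_wpM2r// norm1_col_le.
Qed.

(** In row [i] of [M^t* *m M *m h] the diagonal coefficient is at least [w ^+ 2] and the others at
    most [mu * w ^+ 2]. The off-diagonal terms see only [norm1 h - normc (h i 0)], and moving the
    subtracted part to the left produces the factor [1 + mu]. *)
Lemma coherence_entry_le (h : 'cV[R[i]]_n) (t : R) i : 0 <= t ->
    (forall l, normc ((M *m h) l 0) <= t) ->
  (1 + mu) * normc (h i 0) <= entry_sum M / w ^+ 2 * t + mu * norm1 h.
Proof.
move=> t0 ht; have w0 := omega_min_gt0 i.
have w20 : 0 < w ^+ 2 by rewrite exprn_gt0.
have rest : (M^t* *m M *m h) i 0 - (M^t* *m M) i i * h i 0 =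
    \sum_(j | j != i) (M^t* *m M) i j * h j 0.
  by rewrite [X in X - _]mxE (bigD1 i)//= [LHS]addrC addKr.
have restle : normc (\sum_(j | j != i) (M^t* *m M) i j * h j 0) <=
    mu * w ^+ 2 * (norm1 h - normc (h i 0)).
  apply: le_trans (normc_sum _ _) _.
  have -> : norm1 h - normc (h i 0) = \sum_(j | j != i) normc (h j 0).
    by rewrite /norm1 (bigD1 i)//= [LHS]addrC addKr.
  rewrite mulr_sumr.
  apply: ler_sum => j ji.
  by rewrite Normc.normcM ler_wpM2r ?normc_ge0// gram_offdiag// eq_sym.
have diag : w ^+ 2 * normc (h i 0) <= normc ((M^t* *m M) i i * h i 0).
  rewrite Normc.normcM ler_wpM2r ?normc_ge0// gram_diag.
  by rewrite lerXn2r ?nnegrE ?sqrtr_ge0 ?(ltW w0)// omega_min_le.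
have tri : normc ((M^t* *m M) i i * h i 0) <=
    entry_sum M * t + mu * w ^+ 2 * (norm1 h - normc (h i 0)).
  (* The diagonal term is the whole row minus its off-diagonal part. *)
  rewrite -[X in normc X](subKr ((M^t* *m M *m h) i 0)) /= rest.
  by apply: le_trans (normc_distr _ _) _; rewrite lerD// gram_mul_le.
rewrite -(ler_pM2l w20).
have := le_trans diag tri; move: (entry_sum M) (norm1 h) (normc _) mu => B N a c.
move: (w ^+ 2) w20 => v v0.
have -> : v * (B / v * t + c * N) = B * t + c * v * N by field; rewrite gt_eqF.
lra.
Qed.

End Coherence.

(** * The cone condition forced by l1 minimality *)

Section Cone.
Variables (R : realType) (n k : nat).
Implicit Types u h : 'cV[R[i]]_n.
Local Notation normc := (@Normc.normc R).

Lemma sigmaE u :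
  sigma k u = \sum_(i | i \notin largest_entries k u) normc (u i 0).
Proof.
rewrite /sigma /norm1 [RHS]big_mkcond; apply: eq_bigr => i _.
by rewrite !mxE; case: ifP; rewrite ?subrr ?subr0 ?Normc.normc0.
Qed.

Lemma card_largest_entries u : (#|largest_entries k u| <= k)%N.
Proof.
by apply: leq_trans (card_size _) _; rewrite size_take; case: ltnP.
Qed.

(** The triangle inequality is used in opposite roles: on [S] it bounds [u] by [u + h] and [h], off
    [S] it bounds [h] by [u + h] and [u]. Adding both to the hypothesis cancels every [u + h]
    term. *)
Lemma norm1_cone u h : norm1 (u + h) <= norm1 u ->
  norm1 h <= 2 * \sum_(i in largest_entries k u) normc (h i 0) + 2 * sigma k u.
Proof.
rewrite sigmaE; set S := largest_entries k u.
have norm1_split (v : 'cV[R[i]]_n) : norm1 v =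
    \sum_(i in S) normc (v i 0) + \sum_(i | i \notin S) normc (v i 0).
  exact: bigID.
rewrite !norm1_split => le_uh.
have inS : \sum_(i in S) normc (u i 0) <=
    \sum_(i in S) normc ((u + h) i 0) + \sum_(i in S) normc (h i 0).
  rewrite -big_split ler_sum//= => i _.
  rewrite mxE; apply: le_trans (normc_distr _ _).
  by rewrite addrK.
have notinS : \sum_(i | i \notin S) normc (h i 0) <=
    \sum_(i | i \notin S) normc ((u + h) i 0) +
    \sum_(i | i \notin S) normc (u i 0).
  rewrite -big_split ler_sum//= => i _.
  rewrite mxE; apply: le_trans (normc_distr _ _).
  by rewrite [u i 0 + _]addrC addrK.
lra.
Qed.

End Cone.

(** * The l1 error bound under the coherence condition *)

Section RobustRecovery.
Variables (R : realType) (m n : nat) (M : 'M[R[i]]_(m, n)) (k : nat).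
Hypothesis Mcol : forall j, col j M != 0.
Local Notation normc := (@Normc.normc R).
Local Notation mu := (coherence M).

(** If [mu = 0] the assumed bound on [k] is infinite, and the gap is simply 1. Otherwise multiply
    the assumption by [mu]. *)
Lemma coherence_gap :
  ((k%:R : R)%:E < (2^-1 : R)%:E * (1 + (mu%:E)^-1))%E ->
  0 < 1 + mu - 2 * k%:R * mu.
Proof.
rewrite inver; case: eqVneq => [-> _|mu0]; first by lra.
rewrite -EFinD -EFinM lte_fin => hk.
have mu_gt0 : 0 < mu by rewrite lt_neqAle eq_sym mu0 coherence_ge0.
have := hk; rewrite -(ltr_pM2r mu_gt0) -mulrA mulrDl mulVf// mul1r; lra.
Qed.

Lemma norm1_recovery (u h : 'cV[R[i]]_n) (t : R) : 0 <= t ->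
    (forall l, normc ((M *m h) l 0) <= t) -> norm1 (u + h) <= norm1 u ->
  (1 + mu - 2 * k%:R * mu) * norm1 h <=
  2 * k%:R * (entry_sum M / omega_min M ^+ 2) * t + 2 * (1 + mu) * sigma k u.
Proof.
move=> t0 ht cone; have := norm1_cone k cone.
set S := largest_entries k u; set B := entry_sum M / _.
have mu0 := coherence_ge0 M.
have B0 : 0 <= B by rewrite divr_ge0 ?entry_sum_ge0 ?sqr_ge0.
(* [S] may have fewer than [k] elements; nonnegativity allows its cardinal to be replaced by [k]. *)
have c0 : 0 <= B * t + mu * norm1 h.
  by rewrite addr_ge0// mulr_ge0// norm1_ge0.
have sumS : (1 + mu) * \sum_(i in S) normc (h i 0) <=
    k%:R * (B * t + mu * norm1 h).
  apply: (@le_trans _ _ (\sum_(i in S) (B * t + mu * norm1 h))).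
    by rewrite mulr_sumr ler_sum// => i _; exact: coherence_entry_le.
  rewrite sumr_const -[leLHS]mulr_natl ler_wpM2r// ler_nat.
  exact: card_largest_entries.
(* Once the cone bound is scaled by [1 + mu], [sumS] bounds its sum over [S], and the resulting
   [2 * k%:R * mu * norm1 h] is absorbed on the left. *)
rewrite -(@ler_pM2l _ (1 + mu)); last by lra.
lra.
Qed.

End RobustRecovery.

(** * Return from the analysis coefficients to the signal *)

Lemma mpinv_mulVmx (C : numClosedFieldType) m n (M : 'M[C]_(m, n)) :
  \rank M = n -> mpinv M *m M = 1%:M.
Proof.
move=> rM; have /row_fullP[L LM] : row_full M by rewrite /row_full rM.
have [MXM _ _ _] := mpinvP M.
(* The left inverse [L] cancels the leading [M] in the Penrose identity [M X M = M]. *)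
by rewrite -[LHS]mul1mx -LM -!mulmxA (mulmxA M) MXM.
Qed.

Theorem corollary2 (R : realType) (m n p : nat)
    (A : 'M[R[i]]_(m, p)) (Psi : 'M[R[i]]_(n, p))
    (hnp : (p <= n)%N) (hPsi : \rank Psi = p)
    (hcol : forall j : 'I_n, col j (A *m mpinv Psi) != 0)
    (k : nat)
    (hk : ((k%:R : R)%:E
           < (2^-1 : R)%:E * (1 + ((coherence (A *m mpinv Psi))%:E)^-1))%E) :
  exists C0 C1 : R, [/\ 0 <= C0, 0 <= C1 &
    forall (eps : R) (x : 'cV[R[i]]_p) (e : 'cV[R[i]]_m),
      0 <= eps -> norm2 e <= eps ->
      forall xs : 'cV[R[i]]_p,
        is_solution A Psi (A *m x + e) eps xs ->
        norm2 (xs - x) <= C0 * eps + C1 * sigma k (Psi *m x)].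
Proof.
have gap := coherence_gap hk.
have PV := mpinv_mulVmx hPsi.
set M := A *m mpinv Psi in hcol gap *; set D := 1 + _ - _ in gap.
have mu0 := coherence_ge0 M.
have P0 := entry_sum_ge0 (mpinv Psi).
(* Both constants come from [norm1_recovery] at [t = 2 * eps], divided by the gap [D]; the factor
   [entry_sum (mpinv Psi)] pays for passing from [h] to [xs - x]. *)
exists (entry_sum (mpinv Psi) *
        (2 * k%:R * (entry_sum M / omega_min M ^+ 2) * 2 / D)).
exists (entry_sum (mpinv Psi) * (2 * (1 + coherence M) / D)).
split.
- rewrite mulr_ge0// divr_ge0 ?(ltW gap)// mulr_ge0// mulr_ge0//.
    by rewrite mulr_ge0.
  by rewrite divr_ge0 ?entry_sum_ge0 ?sqr_ge0.
- by rewrite mulr_ge0// divr_ge0 ?(ltW gap)// mulr_ge0// addr_ge0.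
move=> eps x e eps0 he xs [feas opt].
set h := Psi *m (xs - x).
have xh : xs - x = mpinv Psi *m h by rewrite mulmxA PV mul1mx.
have Mh : M *m h = A *m (xs - x) by rewrite -mulmxA -xh.
have Mhle l : Normc.normc ((M *m h) l 0) <= 2 * eps.
  (* A difference of the residuals of [x] and [xs], each of size at most [eps]. *)
  have -> : M *m h = e - (A *m x + e - A *m xs).
    by rewrite Mh mulmxBr opprB addrCA [A *m x + e]addrC opprD addNKr.
  rewrite mxE mxE; apply: le_trans (normc_distr _ _) _.
  rewrite mulr_natl mulr2n lerD//.
    by apply: le_trans he; exact: normc_le_norm2.
  by apply: le_trans feas; exact: normc_le_norm2.
(* The residual of [x] is [e], so [x] competes with the minimizer [xs]. *)
have xfeas : feasible A (A *m x + e) eps x.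
  by rewrite /feasible [A *m x + e]addrC addrK.
have cone : norm1 (Psi *m x + h) <= norm1 (Psi *m x).
  by rewrite -mulmxDr addrC subrK; exact: opt.
have t0 : 0 <= 2 * eps by rewrite mulr_ge0.
have := norm1_recovery k hcol t0 Mhle cone; rewrite -/D => rec.
apply: le_trans (norm2_le_norm1 _) _; rewrite xh.
apply: le_trans (norm1_mulmx _ _) _.
rewrite -!(mulrA (entry_sum (mpinv Psi))) -mulrDr ler_wpM2l// -(ler_pM2l gap).
apply: le_trans rec _; rewrite le_eqVlt; apply/orP; left; apply/eqP.
(* [omega_min M] may vanish, so its quotient must stay opaque to [field]. *)
move: (entry_sum M / _) D gap => B D gap.
by field; rewrite gt_eqF.
Qed.
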